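(* Let $r,k,t$ be integers satisfying $k-1 \ge t+1 \ge r\ge 2$, let $D = 2r(t+1)-(2r-3)k$, and suppose $k<D$. Then there is a linear-time reduction that, given an $n$-vertex $r$-uniform hypergraph $G$ (an ordinary graph when $r=2$), produces an instance of unweighted undirected $n$-Pairs Minimum Distance on a graph with $O(kn^{t})$ vertices and $O(kn^{t+1})$ edges, such that: (1) if $G$ contains a $k$-(hyper)clique, then the $n$-pairs minimum distance of the produced instance equals $k$; (2) if $G$ does not contain a $k$-(hyper)clique, then the $n$-pairs minimum distance of the produced instance is at least $D$.
   Context: The $n$-Pairs Minimum Distance problem: given a graph with $N$ vertices and a set of $O(N)$ vertex pairs $(s_i,t_i)$, compute $\min_i d(s_i,t_i)$, where $d$ is the shortest-path distance; this minimum is called the $n$-pairs minimum distance. A $k$-hyperclique in an $r$-uniform hypergraph is a set of $k$ vertices every $r$-subset of which is a hyperedge (for $r=2$ this is a $k$-clique). *)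

(* Defs.v *)
From mathcomp Require Import all_boot.
Set Implicit Arguments.
Unset Strict Implicit.
Unset Printing Implicit Defensive.

Definition uniform r n (E : {set {set 'I_n}}) : bool :=
  [forall e in E, #|e| == r].

Definition hyperclique r k n (E : {set {set 'I_n}}) (K : {set 'I_n}) : bool :=
  (#|K| == k) &&
  [forall e : {set 'I_n}, (e \subset K) && (#|e| == r) ==> (e \in E)].

Definition has_hyperclique r k n (E : {set {set 'I_n}}) : bool :=
  [exists K : {set 'I_n}, hyperclique r k E K].

Record instance := Instance {
  nvert : nat;
  edges : seq ('I_nvert * 'I_nvert);
  pairs : seq ('I_nvert * 'I_nvert) }.

(* The edge list describes a simple undirected graph: no loops, and every *)
(* edge is listed once, in only one of its two orientations.  The list of *)
(* pairs represents a set, hence has no repetition.                       *)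
Definition well_formed (I : instance) : bool :=
  [&& all (fun e => e.1 != e.2) (edges I),
      uniq [seq [set e.1; e.2] | e <- edges I]
    & uniq (pairs I)].

Definition adj (I : instance) : rel 'I_(nvert I) :=
  [rel u v | ((u, v) \in edges I) || ((v, u) \in edges I)].

Definition walk (I : instance) (d : nat) (u v : 'I_(nvert I)) : bool :=
  [exists p : d.-tuple 'I_(nvert I), path (adj (I := I)) u p && (last u p == v)].

Lemma connect_walk (I : instance) (u v : 'I_(nvert I)) :
  connect (adj (I := I)) u v -> exists d, walk d u v.
Proof.
case/connectP=> p up ->; exists (size p).
by apply/existsP; exists (in_tuple p); rewrite up eqxx.
Qed.

(* None is +oo: there is no path. *)
Definition dist (I : instance) (u v : 'I_(nvert I)) : option nat :=
  match @idP (connect (adj (I := I)) u v) with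
  | ReflectT uv => Some (ex_minn (connect_walk uv))
  | ReflectF _ => None
  end.

Definition omin (a b : option nat) : option nat :=
  match a, b with
  | Some x, Some y => Some (minn x y)
  | Some x, None => Some x
  | None, _ => b
  end.

Definition ole (a b : option nat) : bool :=
  match a, b with
  | _, None => true
  | None, Some _ => false
  | Some x, Some y => x <= y
  end.

Definition pairs_min_dist (I : instance) : option nat :=
  foldr (fun st => omin (dist st.1 st.2)) None (pairs I).

(* The word RAM with w-bit words, presented as a while language over      *)
(* registers and a random-access memory, with a write-only output tape.   *)
(* Arithmetic is modulo 2 ^ w; comparisons return 0 or 1; each operation, *)
(* constant, register or memory access and test costs one unit.           *)

Inductive binop := Add | Sub | Mul | Div | Mod | Eq | Lt.

Inductive expr :=
  | Const of nat
  | Reg of nat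
  | Fetch of expr
  | Bin of binop & expr & expr.

Inductive prog :=
  | Skip
  | Assign of nat & expr
  | Store of expr & expr        (* address, value *)
  | Emit of expr
  | Seq of prog & prog
  | If of expr & prog & prog    (* a nonzero word counts as true *)
  | While of expr & prog.

Record state := State {
  regs : nat -> nat;
  mem : nat -> nat;
  out : seq nat }.

Definition upd (f : nat -> nat) (x v : nat) : nat -> nat :=
  fun y => if y == x then v else f y.

Definition binop_eval (w : nat) (o : binop) (a b : nat) : nat :=
  match o with
  | Add => (a + b) %% 2 ^ w
  | Sub => (a + 2 ^ w - b) %% 2 ^ w
  | Mul => (a * b) %% 2 ^ w
  | Div => a %/ b
  | Mod => a %% b
  | Eq => a == b
  | Lt => a < b
  end.

Fixpoint eval (w : nat) (s : state) (e : expr) : nat :=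
  match e with
  | Const c => c %% 2 ^ w
  | Reg x => regs s x
  | Fetch a => mem s (eval w s a)
  | Bin o e1 e2 => binop_eval w o (eval w s e1) (eval w s e2)
  end.

Fixpoint cost (e : expr) : nat :=
  match e with
  | Const _ | Reg _ => 1
  | Fetch a => (cost a).+1
  | Bin _ e1 e2 => (cost e1 + cost e2).+1
  end.

(* T is the running time. *)
Inductive exec (w : nat) : prog -> state -> nat -> state -> Prop :=
  | exec_skip s : exec w Skip s 1 s
  | exec_assign x e s :
      exec w (Assign x e) s (cost e).+1
        (State (upd (regs s) x (eval w s e)) (mem s) (out s))
  | exec_store a e s :
      exec w (Store a e) s (cost a + cost e).+1
        (State (regs s) (upd (mem s) (eval w s a) (eval w s e)) (out s))
  | exec_emit e s :
      exec w (Emit e) s (cost e).+1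
        (State (regs s) (mem s) (rcons (out s) (eval w s e)))
  | exec_seq p1 p2 s1 s2 s3 T1 T2 :
      exec w p1 s1 T1 s2 -> exec w p2 s2 T2 s3 ->
      exec w (Seq p1 p2) s1 (T1 + T2) s3
  | exec_if e p1 p2 s s' T :
      exec w (if eval w s e != 0 then p1 else p2) s T s' ->
      exec w (If e p1 p2) s (cost e + T).+1 s'
  | exec_while_done e p s :
      eval w s e = 0 -> exec w (While e p) s (cost e).+1 s
  | exec_while_step e p s1 s2 s3 T1 T2 :
      eval w s1 e != 0 -> exec w p s1 T1 s2 -> exec w (While e p) s2 T2 s3 ->
      exec w (While e p) s1 (cost e + T1 + T2).+1 s3.

(* Input: register 0 holds n, and the memory holds the adjacency tensor   *)
(* of the hypergraph as an n x ... x n array (r factors): the cell whose  *)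
(* address has base-n digits v_0, ..., v_(r-1) is 1 if {v_0,...,v_(r-1)}  *)
(* is a hyperedge.  Everything else is 0.                                 *)
Definition tensor r n (E : {set {set 'I_n}}) (a : nat) : bool :=
  [exists v : r.-tuple 'I_n,
     (a == \sum_(j < r) tnth v j * n ^ j) && ([set x in v] \in E)].

Definition input r n (E : {set {set 'I_n}}) : state :=
  State (upd (fun=> 0) 0 n) (fun a => tensor r E a) [::].

(* Output: the number of vertices, the number of pairs, the pairs, and    *)
(* then, up to the end of the tape, the edges.                            *)
Definition encode (I : instance) : seq nat :=
  let flat l := flatten [seq [:: val uv.1; val uv.2] | uv <- l] in
  [:: nvert I; size (pairs I)] ++ flat (pairs I) ++ flat (edges I).

(* On input E the program p writes I within time b, whatever the word     *)
(* length w as long as b <= 2 ^ w; thus, when b is polynomial in n, words *)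
(* of O(log n) bits suffice.                                              *)
Definition produces_within r n (p : prog) (b : nat) (E : {set {set 'I_n}})
    (I : instance) : Prop :=
  forall w, b <= 2 ^ w ->
  exists T s, [/\ exec w p (input r E) T s, out s = encode I & T <= b].

(* Main.v *)
(* The graph has layers 0, ..., k whose vertices are the t-tuples of       *)
(* vertices of G, read in layer l as the values at the positions l, ...,   *)
(* l + t - 1 modulo k.  An edge between layers i and i + 1 is a            *)
(* (t + 1)-tuple for the window of positions i, ..., i + t, in which       *)
(* every r positions carry a hyperedge.                                    *)
(* The pairs join the two copies of each tuple in layers 0 and k, so a     *)
(* k-hyperclique gives a pair at distance k.  Conversely, a walk of length *)
(* d between the two copies crosses each of the k gaps between layers an   *)
(* odd number of times, hence at most (d - k) / 2 of them more than once.  *)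
(* The windows crossed exactly once agree with each other: between two     *)
(* such crossings the walk stays in layers that keep the common positions. *)
(* A set of r positions is contained in all but at most r (k - t - 1) of   *)
(* the k windows; when d < D, one of the remaining ones is crossed once.   *)
(* So the values in the windows crossed once form a k-hyperclique.         *)

Require Import Defs.
From mathcomp Require Import all_boot zify.

Set Implicit Arguments.
Unset Strict Implicit.
Unset Printing Implicit Defensive.

(** The bound [D] equals 3k - 2r(k-t-1), so a walk length d is below [D] exactly when (d-k)/2 +
    r(k-t-1) < k. The first summand bounds the windows crossed more than once
    ([card_multiply_crossed]), the second those missing one of r given positions ([card_offset_gt]);
    hence some window contains all r positions and is crossed once ([window_crossed_once]). Windows
    crossed once agree on common positions, by [windows_agree] and, through the identification of
    layers 0 and k, by [windows_agree_wrap]. They therefore define one label per position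
    ([closed_walk_labelling]), and any r labels form a hyperedge. Uniformity and r >= 2 make the
    labels distinct, so they are a k-hyperclique ([layer_walk_hyperclique]). In the other direction,
    a hyperclique read cyclically is a walk of length k between paired vertices
    ([hyperclique_walk]), and no such walk is shorter because a step changes the layer by one
    ([layer_walk_length]). For the algorithm, r, k and t are constants of the program, so testing a
    window and computing the ends of an edge are expressions of constant size. Two counting loops,
    over the pairs and over the candidate edges, write the instance within the time bound
    ([reduction_runs]). *)

(** * Base-[n] numerals and the addresses of the adjacency tensor *)

Definition numeral (n : nat) (ds : seq nat) : nat :=
  foldr (fun d a => d + n * a) 0 ds.

Definition digit (n w c : nat) : nat := w %/ n ^ c %% n.

Lemma numeral_cat n s1 s2 :
  numeral n (s1 ++ s2) = numeral n s1 + n ^ size s1 * numeral n s2.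
Proof.
elim: s1 => [|d s1 IH] /=; first by rewrite mul1n.
by rewrite IH expnS mulnDr addnA mulnA.
Qed.

Lemma numeral_lt n ds : all (fun d => d < n) ds -> numeral n ds < n ^ size ds.
Proof.
elim: ds => [|d ds IH] //= /andP[dn /IH lt_ds]; rewrite expnS.
by have := leq_mul (leqnn n) lt_ds; rewrite mulnS; lia.
Qed.

Lemma numeral_inj n s1 s2 :
  size s1 = size s2 -> all (fun d => d < n) s1 -> all (fun d => d < n) s2 ->
  numeral n s1 = numeral n s2 -> s1 = s2.
Proof.
elim: s1 s2 => [|d s1 IH] [|d' s2] //= [sz] /andP[dn a1] /andP[d'n a2] eq12.
have dd' : d = d'.
  have := congr1 (modn^~ n) eq12.
  by rewrite ![_ + n * _]addnC ![n * _]mulnC !modnMDl !modn_small.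
move: eq12; rewrite dd' => /addnI /eqP; rewrite eqn_pmul2l; last by lia.
by move=> /eqP /IH ->.
Qed.

Lemma numeral_sum n r (v : r.-tuple 'I_n) :
  \sum_(j < r) tnth v j * n ^ j = numeral n (map val v).
Proof.
elim: r v => [|r IH] v; first by rewrite big_ord0 (tuple0 v).
case/tupleP: v => x v; rewrite big_ord_recl /= muln1 tnth0 -IH; congr (_ + _).
rewrite big_distrr /=; apply: eq_bigr => j _.
by rewrite tnthS /bump /= add1n expnS mulnCA.
Qed.

Lemma digit_lt n w c : 0 < n -> digit n w c < n.
Proof. exact: ltn_pmod. Qed.

Lemma digit_modn n t w c : c < t -> digit n (w %% n ^ t) c = digit n w c.
Proof.
move=> ct; case: n => [|n]; first by rewrite /digit !modn0 exp0n ?modn0 //; lia.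
have cE : n.+1 ^ t = n.+1 ^ (t - c.+1) * n.+1 * n.+1 ^ c.
  by rewrite -mulnA -expnS -expnD; congr (_ ^ _); lia.
rewrite {2}(divn_eq w (n.+1 ^ t)) /digit cE mulnA divnMDl ?expn_gt0 //.
by rewrite mulnA modnMDl.
Qed.

Lemma digit_divn n w c : digit n (w %/ n) c = digit n w c.+1.
Proof. by rewrite /digit expnS divnMA. Qed.

Lemma digit_numeral n ds c :
  all (fun d => d < n) ds -> c < size ds -> digit n (numeral n ds) c = nth 0 ds c.
Proof.
elim: ds c => [|d ds IH] //= c /andP[dn dsn].
case: c => [|c] /= cs; first by rewrite /digit divn1 addnC mulnC modnMDl modn_small.
rewrite -digit_divn addnC mulnC divnMDl ?divn_small ?addn0 ?IH //; lia.
Qed.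

Lemma tensor_numeral r n (E : {set {set 'I_n}}) (s : seq 'I_n) :
  size s = r -> tensor r E (numeral n (map val s)) = ([set x in s] \in E).
Proof.
move=> sz; apply/existsP/idP => [[v /andP[/eqP]]|sE]; last first.
  move/eqP: sz => sz; exists (Tuple sz).
  by rewrite numeral_sum eqxx /=.
rewrite numeral_sum => eq_vs vE; suff -> : s = v by [].
have ltE (s' : seq 'I_n) : all (fun d => d < n) (map val s').
  by apply/allP => _ /mapP[x _ ->]; exact: ltn_ord.
apply: (inj_map val_inj); apply: numeral_inj eq_vs => //.
by rewrite !size_map size_tuple.
Qed.

(** * Cyclic windows and closed walks through the layers *)

(** The index of position [p] inside the cyclic window that starts at [i]. Adding [k] first keeps
    the natural subtraction exact for [i < k]. *)
Definition offset (k i p : nat) : nat := (p + k - i) %% k.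

Lemma offset_lift k i p :
  i < k -> p < k -> offset k i p = (if i <= p then p else p + k) - i.
Proof.
move=> ik pk; rewrite /offset; case: ifP => ip; last by rewrite modn_small //; lia.
by rewrite -addnBAC // modnDr modn_small //; lia.
Qed.

Section ClosedWalk.

Variables (n t k d : nat) (good : pred nat) (l a : nat -> nat).

(** Here [u] and [v] are times of the walk, [u] at the lower end of the edge with window [w]; a
    downward step is [traverses w j.+1 j]. The lower tuple drops the last entry of [w], the upper
    one drops the first. *)
Definition traverses (w u v : nat) : Prop :=
  [/\ l v = (l u).+1, a u = w %% n ^ t & a v = w %/ n].

Hypotheses (t_gt0 : 0 < t) (tk : t < k).
Hypothesis steps : forall j, j < d -> exists w,
  [/\ good w, minn (l j) (l j.+1) < k & traverses w j j.+1 \/ traverses w j.+1 j].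
Hypotheses (l0 : l 0 = 0) (ld : l d = k) (ad : a d = a 0).

Definition crossings (i m : nat) : nat :=
  \sum_(j < m) (minn (l j) (l j.+1) == i).

Lemma crossingsS i m :
  crossings i m.+1 = crossings i m + (minn (l m) (l m.+1) == i).
Proof. exact: big_ord_recr. Qed.

Lemma leq_crossings i m m' : m <= m' -> crossings i m <= crossings i m'.
Proof.
by move/subnK <-; elim: (m' - m) => // e IH; rewrite addSn crossingsS; lia.
Qed.

Lemma step_layer j : j < d -> l j.+1 = (l j).+1 \/ l j = (l j.+1).+1.
Proof. by case/steps=> w [_ _ [[]|[]]]; [left|right]. Qed.

(** The walk starts below every gap, and a step changes the side of gap [i] exactly when it crosses
    that gap. *)
Lemma odd_crossings i m : m <= d -> odd (crossings i m) = (i < l m).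
Proof.
elim: m => [|m IH] md; first by rewrite /crossings big_ord0 l0.
by rewrite crossingsS oddD IH ?oddb; last exact: ltnW; case: (step_layer md); lia.
Qed.

Lemma sum_crossings m : m <= d -> \sum_(i < k) crossings i m = m.
Proof.
elim: m => [|m IH] md.
  by rewrite big1 // => i _; rewrite /crossings big_ord0.
under eq_bigr => i _ do rewrite crossingsS.
rewrite big_split /= IH; last exact: ltnW.
have [w [_ lt_k _]] := steps md.
rewrite (bigD1 (Ordinal lt_k)) //= eqxx big1 ?addn0 ?addn1 // => i.
by rewrite -val_eqE /= eq_sym; case: eqP.
Qed.

(* Each of the [k] gaps between layers is crossed an odd number of times. *)
Lemma card_multiply_crossed :
  k + 2 * #|[set i : 'I_k | crossings i d != 1]| <= d.
Proof.
rewrite -{2}(sum_crossings (leqnn d)) -sum1dep_card big_distrr /= big_mkcond /=.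
rewrite -{1}(card_ord k) -sum1_card -big_split /=.
apply: leq_sum => i _; have := odd_crossings i (leqnn d).
by rewrite ld ltn_ord; case: (crossings i d) => [|[|[|c]]].
Qed.

Definition crosses_at (i w : nat) (tau : nat) : Prop :=
  [/\ tau < d, l tau = i, traverses w tau tau.+1,
      forall j, j <= tau -> l j <= i & forall j, tau < j <= d -> i < l j].

(** The crossing ends at the first time above gap [i]. From then on the number of crossings lies
    between an odd number and 1, so it stays 1, and by parity the walk stays above. *)
Lemma single_crossing i :
  i < k -> crossings i d = 1 -> exists w, good w /\ exists tau, crosses_at i w tau.
Proof.
move=> ik ci1.
have ex_above : exists m, i < l m by exists d; rewrite ld.
case: (ex_minnP ex_above) => m0 im0 min_m0.
have m0d : m0 <= d by apply: min_m0; rewrite ld.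
case: m0 im0 min_m0 m0d => [|tau] im0 min_m0 m0d; first by rewrite l0 in im0.
have below j : j <= tau -> l j <= i.
  by move=> jt; rewrite leqNgt; apply/negP=> /min_m0; lia.
have above j : tau < j <= d -> i < l j.
  case/andP=> tj jd; rewrite -odd_crossings //.
  have := odd_crossings i m0d; rewrite im0.
  have := leq_crossings i tj; have := leq_crossings i jd; rewrite ci1.
  by case: (crossings i j) => [|[|?]] //; case: (crossings i tau.+1).
have [w [gw _ stepw]] := steps m0d; exists w; split=> //; exists tau.
have lt := below _ (leqnn tau).
case: stepw => [[lE aE aE']|[lE _ _]]; last by lia.
by split=> //; lia.
Qed.

(** [P] is a position not reduced modulo [k], so the tuple at time [j] holds it at index [P - l j].
    Both ends of an edge copy their entries from one window, so a step only shifts this index. *)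
Lemma digit_kept P u v :
  u <= v <= d -> (forall j, u <= j <= v -> l j <= P < l j + t) ->
  digit n (a u) (P - l u) = digit n (a v) (P - l v).
Proof.
case/andP=> uv; rewrite -(subnKC uv); elim: (v - u) => [|e IH]; first by rewrite addn0.
rewrite addnS => ued Pin; rewrite IH; first last.
- by move=> j ?; apply: Pin; lia.
- exact: ltnW.
have {IH} Pe := Pin (u + e) ltac:(lia); have {Pin} PSe := Pin (u + e).+1 ltac:(lia).
have [w [_ _ [[lE aE aE']|[lE aE aE']]]] := steps ued; rewrite aE aE'.
  by rewrite digit_divn digit_modn; [congr digit; lia|lia].
by rewrite digit_divn digit_modn; [congr digit; lia|lia].
Qed.

Lemma digit_entering i w tau P :
  crosses_at i w tau -> i < P <= i + t ->
  digit n w (P - i) = digit n (a tau.+1) (P - l tau.+1).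
Proof.
case=> _ lt [lS _ ->] _ _ iP; rewrite digit_divn lS lt; congr digit; lia.
Qed.

Lemma digit_leaving i w tau P :
  crosses_at i w tau -> i <= P < i + t ->
  digit n w (P - i) = digit n (a tau) (P - l tau).
Proof. by case=> _ -> [_ -> _] _ _ iP; rewrite digit_modn //; lia. Qed.

(** Between the two crossings the layers stay strictly above [i] and at most [i']. All tuples on the
    way thus contain [P], which leaves [w] through its upper tuple and enters [w'] through its lower
    one. *)
Lemma windows_agree i w tau i' w' tau' P :
  crosses_at i w tau -> crosses_at i' w' tau' -> i < i' -> i' <= P <= i + t ->
  digit n w (P - i) = digit n w' (P - i').
Proof.
move=> cr cr' ii' Pin.
rewrite (digit_entering cr) ?(digit_leaving cr'); try lia.
case: cr cr' => td lt _ below above [t'd lt' _ below' above'].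
have tt' : tau < tau' by rewrite ltnNge; apply/negP=> /below; lia.
apply: digit_kept; first by lia.
move=> j jin; have := above j ltac:(lia); have := below' j ltac:(lia); lia.
Qed.

(* Layer [k] is a copy of layer [0], so position [P + k] stands for [P]. *)
Lemma windows_agree_wrap i w tau i' w' tau' P :
  i < k -> i' < k ->
  crosses_at i w tau -> crosses_at i' w' tau' -> i < i' ->
  i <= P <= i + t -> i' <= P + k <= i' + t ->
  digit n w (P - i) = digit n w' (P + k - i').
Proof.
move=> ik i'k cr cr' ii' Pin Pin'.
rewrite (digit_leaving cr) ?(digit_entering cr'); try lia.
case: cr cr' => td lt _ below above [t'd lt' [lS' _ _] below' above'].
(* The bounds force [P < t]. The value is followed back from the earlier crossing to time 0, moved
   to time [d] by [ad], and followed back from there to the later crossing. *)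
have -> : digit n (a tau) (P - l tau) = digit n (a 0) P.
  have {2}-> : P = P - l 0 by rewrite l0 subn0.
  apply/esym; apply: digit_kept; first by lia.
  by move=> j jin; have := below j ltac:(lia); lia.
rewrite -ad; have {1}-> : P = P + k - l d by rewrite ld addnK.
apply/esym; apply: digit_kept; first by lia.
move=> j jin; have := above' j ltac:(lia).
have [->|] := eqVneq j d; first by lia.
move=> jd; have [w'' [_ + st]] := @steps j ltac:(lia).
by case: st => [[lE _ _]|[lE _ _]]; lia.
Qed.

(** The case where [p] wraps around in the window at [i] but not in the later one at [i'] is
    impossible. If both or neither wrap, [windows_agree] applies; if only the later one does,
    [windows_agree_wrap]. *)
Lemma crosses_at_agree i w i' w' tau tau' p :
  i < k -> i' < k -> p < k ->
  crosses_at i w tau -> crosses_at i' w' tau' -> i < i' ->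
  offset k i p <= t -> offset k i' p <= t ->
  digit n w (offset k i p) = digit n w' (offset k i' p).
Proof.
move=> ik i'k pk cr cr' ii'; rewrite !offset_lift //.
case: ifP => ip; case: ifP => ip' off off'; try lia.
- by apply: windows_agree cr cr' ii' _; lia.
- by apply: windows_agree_wrap cr cr' ii' _ _ => //; lia.
- by apply: windows_agree cr cr' ii' _; lia.
Qed.

(** For fixed [p] the offset is injective in [i], and only [k - t.+1] residues exceed [t]. *)
Lemma card_offset_gt (p : 'I_k) :
  #|[set i : 'I_k | t < offset k i p]| <= k - t.+1.
Proof.
have k_gt0 : 0 < k by lia.
pose f (i : 'I_k) : 'I_k := Ordinal (ltn_pmod (p + k - i) k_gt0).
have f_inj : injective f.
  move=> i j /(congr1 val) /=; rewrite -!/(offset _ _ _) !offset_lift // => eq_ij.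
  by apply: val_inj => /=; move: eq_ij (ltn_ord i) (ltn_ord j) (ltn_ord p); do 2 case: ifP; lia.
rewrite -(card_imset _ f_inj).
have -> : k - t.+1 = #|~: [set widen_ord tk i | i in 'I_t.+1]|.
  have := cardsC [set widen_ord tk i | i in 'I_t.+1].
  rewrite card_imset; last by move=> i j /(congr1 val) /= /val_inj.
  by rewrite !card_ord; lia.
apply/subset_leq_card/subsetP=> _ /imsetP[i + ->]; rewrite !inE => lt_t.
apply/imsetP=> -[j _ /(congr1 val)] /= eq_j.
by have := ltn_ord j; rewrite -eq_j -/(offset _ _ _); lia.
Qed.

(* Each of the [r] residues of [S] is missed by [k - t - 1] of the [k]     *)
(* windows, and [(d - k) / 2] windows may be crossed several times.        *)
Lemma window_crossed_once r (S : {set 'I_k}) :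
  #|S| = r -> d + 2 * r * (k - t.+1) < 3 * k ->
  exists i : 'I_k, crossings i d = 1 /\ forall p, p \in S -> offset k i p <= t.
Proof.
move=> cardS lt_d.
pose B1 := [set i : 'I_k | crossings i d != 1].
pose B2 := \bigcup_(p in S) [set i : 'I_k | t < offset k i p].
have lt_k : #|B1 :|: B2| < #|'I_k|.
  have cB2 : #|B2| <= r * (k - t.+1).
    rewrite -cardS -sum_nat_const.
    apply: (@leq_trans (\sum_(p in S) #|[set i : 'I_k | t < offset k i p]|)); last first.
      by apply: leq_sum => p _; exact: card_offset_gt.
    rewrite /B2; elim/big_rec2: _ => [|p x y _ IH]; first by rewrite cards0.
    by apply: leq_trans (leq_card_setU _ _) _; rewrite leq_add2l.
  rewrite card_ord; apply: leq_ltn_trans (leq_card_setU B1 B2) _.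
  by have := card_multiply_crossed; rewrite -/B1; nia.
have [i iB] : exists i, i \notin B1 :|: B2.
  apply/existsP; rewrite -negb_forall; apply/negP=> /forallP all_in.
  suff : B1 :|: B2 = setT by move=> E; rewrite E cardsT ltnn in lt_k.
  by apply/setP=> i; rewrite all_in inE.
move: iB; rewrite !inE negb_or negbK => /andP[/eqP ci iB]; exists i; split=> // p pS.
rewrite leqNgt; apply: contra iB => off; apply/bigcupP; exists p => //.
by rewrite inE.
Qed.

(** The label of [p] is the value read by any window that is crossed once and contains [p];
    agreement makes the choice immaterial. Where no such window exists, the label is the arbitrary
    value 0. *)
Lemma closed_walk_labelling r :
  d + 2 * r * (k - t.+1) < 3 * k ->
  exists z : 'I_k -> nat, forall S : {set 'I_k}, #|S| = r ->
  exists (i : 'I_k) (w : nat), good w /\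
    forall p, p \in S -> offset k i p <= t /\ digit n w (offset k i p) = z p.
Proof.
move=> lt_d.
have [W HW] : exists W : 'I_k -> nat, forall i : 'I_k, crossings i d = 1 ->
    good (W i) /\ exists tau, crosses_at i (W i) tau.
  apply: (@fin_all_exists _ _ (fun (i : 'I_k) w => crossings i d = 1 ->
    good w /\ exists tau, crosses_at i w tau)) => i.
  have [ci|ci] := eqVneq (crossings i d) 1; last by exists 0 => ?; move/eqP: ci.
  by have [w ?] := single_crossing (ltn_ord i) ci; exists w.
have [z Hz] : exists z : 'I_k -> nat, forall p i : 'I_k, crossings i d = 1 ->
    offset k i p <= t -> digit n (W i) (offset k i p) = z p.
  apply: (@fin_all_exists _ _ (fun (p : 'I_k) z => forall i : 'I_k, crossings i d = 1 ->
    offset k i p <= t -> digit n (W i) (offset k i p) = z)) => p.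
  case: (pickP (fun i : 'I_k => (crossings i d == 1) && (offset k i p <= t))); last first.
    by move=> none; exists 0 => i ci off; have := none i; rewrite ci off.
  move=> i /andP[/eqP ci off]; exists (digit n (W i) (offset k i p)) => j cj offj.
  have [_ [tau cri]] := HW i ci; have [_ [tau' crj]] := HW j cj.
  have [ij|ji|/val_inj -> //] := ltngtP i j.
    by apply/esym/(crosses_at_agree _ _ _ cri crj).
  by apply: (crosses_at_agree _ _ _ crj cri).
exists z => S cardS; have [i [ci Si]] := window_crossed_once cardS lt_d.
have [gw _] := HW i ci; exists i, (W i); split=> // p pS.
by split; [exact: Si|apply: Hz => //; exact: Si].
Qed.

End ClosedWalk.

(** * Walks, distances and the minimum over the pairs *)

Lemma walkP (I : instance) d (u v : 'I_(nvert I)) :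
  reflect (exists x : nat -> 'I_(nvert I),
             [/\ x 0 = u, x d = v & forall j, j < d -> adj (x j) (x j.+1)])
          (walk d u v).
Proof.
apply: (iffP existsP) => [[p /andP[up /eqP lastp]]|[x [x0 xd adjx]]].
  exists (nth u (u :: p)); split=> //.
    by rewrite -[d in nth _ _ d](size_tuple p) -last_nth lastp.
  by move=> j jd; apply: (pathP u up); rewrite size_tuple.
have sz : size (mkseq (fun j => x j.+1) d) == d by rewrite size_mkseq.
exists (Tuple sz); apply/andP; split=> /=.
  apply/(pathP u) => j; rewrite size_mkseq => jd; rewrite nth_mkseq //.
  have -> : nth u (u :: mkseq (fun j => x j.+1) d) j = x j.
    by case: j jd => [|j] jd //=; rewrite nth_mkseq //; lia.
  exact: adjx.
rewrite (last_nth u) size_mkseq; case: d xd {adjx sz} => [|d] xd /=.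
  by rewrite -xd x0.
by rewrite nth_mkseq // xd.
Qed.

Lemma dist_walk (I : instance) (u v : 'I_(nvert I)) d :
  dist u v = Some d -> walk d u v.
Proof.
rewrite /dist; case: {-}_ / idP => // uv [<-].
by case: ex_minnP.
Qed.

Lemma walk_dist (I : instance) (u v : 'I_(nvert I)) d :
  walk d u v -> exists2 d', dist u v = Some d' & d' <= d.
Proof.
move=> w; have uv : connect (adj (I := I)) u v.
  by case/existsP: w => p /andP[up /eqP <-]; apply/connectP; exists p.
rewrite /dist; case: {-}_ / idP => // uv'; eexists; first by [].
by case: ex_minnP => m _; apply.
Qed.

Lemma pairs_min_dist_attained (I : instance) d :
  pairs_min_dist I = Some d -> exists2 st, st \in pairs I & dist st.1 st.2 = Some d.
Proof.
rewrite /pairs_min_dist; elim: (pairs I) d => //= st ps IH d.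
case E1: (dist _ _) => [x|]; case E2: (foldr _ _ _) => [y|] //= [<-].
- have [xy|yx] := leqP x y; first by exists st; rewrite ?mem_head.
  by have [st' st'P ?] := IH _ E2; exists st' => //; rewrite inE st'P orbT.
- by exists st; rewrite ?mem_head.
- by have [st' st'P ?] := IH _ E2; exists st' => //; rewrite inE st'P orbT.
Qed.

Lemma pairs_min_dist_le (I : instance) st d :
  st \in pairs I -> dist st.1 st.2 = Some d ->
  exists2 m, pairs_min_dist I = Some m & m <= d.
Proof.
rewrite /pairs_min_dist; elim: (pairs I) => //= st' ps IH; rewrite inE.
case/predU1P=> [<- ->|/IH{}IH /IH[m -> md]] /=.
  by case: (foldr _ _ _) => [y|] /=; [exists (minn d y); rewrite ?geq_minl | exists d].
by case: (dist _ _) => [x|] /=; [exists (minn x m); rewrite // geq_min md orbT | exists m].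
Qed.

(** * Admissible windows and walks seen as sequences of layers and tuples *)

(** This list depends on [r] and [t] only, so the program can unroll the test over it; hence
    sequences of numbers rather than sets. *)
Definition position_sets (r t : nat) : seq (seq nat) :=
  [seq map val (enum (A : {set 'I_t.+1})) | A in [pred A : {set 'I_t.+1} | #|A| == r]].

Definition window_ok r t n (E : {set {set 'I_n}}) (w : nat) : bool :=
  all (fun S => tensor r E (numeral n (map (digit n w) S))) (position_sets r t).

Lemma window_okP r t n (E : {set {set 'I_n}}) w (x : 'I_t.+1 -> 'I_n) :
  (forall c : 'I_t.+1, digit n w c = x c) ->
  reflect (forall A : {set 'I_t.+1}, #|A| = r -> [set x c | c in A] \in E)
          (window_ok r t E w).
Proof.
move=> xE; have testE (A : {set 'I_t.+1}) : #|A| = r ->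
    tensor r E (numeral n (map (digit n w) (map val (enum A))))
      = ([set x c | c in A] \in E).
  move=> cardA; have -> : map (digit n w) (map val (enum A)) = map val (map x (enum A)).
    by rewrite -!map_comp; apply: eq_map => c /=; rewrite xE.
  rewrite tensor_numeral ?size_map -?cardE //; congr (_ \in E).
  apply/setP=> y; rewrite inE; apply/mapP/imsetP => -[c cA ->]; exists c => //.
    by rewrite mem_enum in cA.
  by rewrite mem_enum.
apply: (iffP allP) => [ok A cardA|ok _ /imageP[A /eqP cardA ->]].
  by rewrite -testE //; apply/ok/imageP; exists A; rewrite ?inE ?cardA.
by rewrite testE // ok.
Qed.

Definition layer_walk k t n (good : pred nat) d (l a : nat -> nat) : Prop :=
  [/\ l 0 = 0, l d = k, a d = a 0 & forall j, j < d -> exists w,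
  [/\ good w, minn (l j) (l j.+1) < k &
      traverses n t l a w j j.+1 \/ traverses n t l a w j.+1 j]].

Lemma layer_walk_length k t n good d l a : layer_walk k t n good d l a -> k <= d.
Proof.
case=> l0 <- _ steps; suff le m : m <= d -> l m <= m by exact: le.
elim: m => [|m IH] md; first by rewrite l0.
have := IH (ltnW md).
by have [w [_ _ [[lE _ _]|[lE _ _]]]] := steps m md; lia.
Qed.

(** * The layered graph *)

Section LayeredGraph.

Variables (k t n : nat).

Definition source (e : nat) : nat :=
  e %/ n ^ t.+1 * n ^ t + e %% n ^ t.+1 %% n ^ t.
Definition target (e : nat) : nat :=
  (e %/ n ^ t.+1).+1 * n ^ t + e %% n ^ t.+1 %/ n.

Hypothesis t_gt0 : 0 < t.

Lemma n_gt0 e : e < k * n ^ t.+1 -> 0 < n.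
Proof. by case: n => //; rewrite exp0n // muln0. Qed.

Lemma divn_window e : e < k * n ^ t.+1 -> e %% n ^ t.+1 %/ n < n ^ t.
Proof.
move=> ek; have n0 := n_gt0 ek.
by rewrite ltn_divLR // -expnSr ltn_mod expn_gt0 n0.
Qed.

Lemma sourceK e : e < k * n ^ t.+1 ->
  source e %/ n ^ t = e %/ n ^ t.+1 /\ source e %% n ^ t = e %% n ^ t.+1 %% n ^ t.
Proof.
move/n_gt0 => n0; have N0 : 0 < n ^ t by rewrite expn_gt0 n0.
rewrite /source divnMDl // modnMDl modn_mod; split=> //.
by rewrite [_ %% _ %/ _]divn_small ?addn0 ?ltn_mod.
Qed.

Lemma targetK e : e < k * n ^ t.+1 ->
  target e %/ n ^ t = (e %/ n ^ t.+1).+1 /\ target e %% n ^ t = e %% n ^ t.+1 %/ n.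
Proof.
move=> ek; have wn := divn_window ek; have n0 := n_gt0 ek.
rewrite /target divnMDl ?expn_gt0 ?n0 // modnMDl [_ %/ _ %% _]modn_small //; split=> //.
by rewrite [_ %/ n %/ _]divn_small ?addn0.
Qed.

Lemma layer_lt e : e < k * n ^ t.+1 -> e %/ n ^ t.+1 < k.
Proof. by move=> ek; rewrite ltn_divLR // expn_gt0 (n_gt0 ek). Qed.

Lemma source_lt (e : 'I_(k * n ^ t.+1)) : source e < k.+1 * n ^ t.
Proof.
have ek := ltn_ord e; rewrite -ltn_divLR ?expn_gt0 ?(n_gt0 ek) //.
by rewrite (sourceK ek).1 ltnS ltnW // layer_lt.
Qed.

Lemma target_lt (e : 'I_(k * n ^ t.+1)) : target e < k.+1 * n ^ t.
Proof.
have ek := ltn_ord e; rewrite -ltn_divLR ?expn_gt0 ?(n_gt0 ek) //.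
by rewrite (targetK ek).1 ltnS layer_lt.
Qed.

Lemma bottom_lt (a : 'I_(n ^ t)) : a < k.+1 * n ^ t.
Proof. by rewrite (leq_trans (ltn_ord a)) // leq_pmull. Qed.

Lemma top_lt (a : 'I_(n ^ t)) : k * n ^ t + a < k.+1 * n ^ t.
Proof. by rewrite mulSn addnC ltn_add2r. Qed.

(* Vertex [l * n ^ t + a] is layer [l] with a [t]-tuple, written in base   *)
(* [n] as [a], for the positions [l], ..., [l + t - 1] modulo [k].  Edge   *)
(* number [i * n ^ (t + 1) + w] joins the two [t]-tuples inside the        *)
(* [(t + 1)]-tuple [w] for the positions [i], ..., [i + t].                *)
Definition layered (good : pred nat) : instance :=
  @Instance (k.+1 * n ^ t)
    [seq (Ordinal (source_lt e), Ordinal (target_lt e))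
    | e : 'I_(k * n ^ t.+1) <- enum 'I_(k * n ^ t.+1) & good (e %% n ^ t.+1)]
    [seq (Ordinal (bottom_lt a), Ordinal (top_lt a)) | a <- enum 'I_(n ^ t)].

Variable good : pred nat.

(** Because [t] is positive, the remainder modulo [n ^ t] determines the one modulo [n], which
    together with the quotient by [n] gives back the window. Hence an edge is determined by its
    ends. *)
Lemma window_inj w w' :
  w %% n ^ t = w' %% n ^ t -> w %/ n = w' %/ n -> w = w'.
Proof.
move=> eqm eqd; rewrite (divn_eq w n) (divn_eq w' n) eqd; congr (_ + _).
have dn : n %| n ^ t by rewrite dvdn_exp.
by rewrite -(modn_dvdm w dn) -(modn_dvdm w' dn) eqm.
Qed.

Lemma edge_inj e e' : e < k * n ^ t.+1 -> e' < k * n ^ t.+1 ->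
  source e = source e' -> target e = target e' -> e = e'.
Proof.
move=> ek e'k es et.
have [sd sm] := sourceK ek; have [sd' sm'] := sourceK e'k.
have [_ tm] := targetK ek; have [_ tm'] := targetK e'k.
rewrite (divn_eq e (n ^ t.+1)) (divn_eq e' (n ^ t.+1)) -sd -sd' es; congr (_ + _).
by apply: window_inj; [rewrite -sm -sm' es|rewrite -tm -tm' et].
Qed.

Lemma source_eq_target e e' : e < k * n ^ t.+1 -> e' < k * n ^ t.+1 ->
  source e = target e' -> e %/ n ^ t.+1 = (e' %/ n ^ t.+1).+1.
Proof. by move=> ek e'k eq_st; rewrite -(sourceK ek).1 eq_st (targetK e'k).1. Qed.

(** A loop would need a layer equal to its successor, and two edges with the same ends in opposite
    orientations would need two layers each the successor of the other. *)
Lemma layered_well_formed : well_formed (layered good).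
Proof.
apply/and3P; split.
- apply/allP=> _ /mapP[e _ ->] /=; apply/eqP=> /(congr1 val).
  by move/(source_eq_target (ltn_ord e) (ltn_ord e))/n_Sn.
- rewrite -map_comp map_inj_uniq; first by rewrite filter_uniq ?enum_uniq.
  move=> e e' /=.
  have ek := ltn_ord e; have e'k := ltn_ord e'.
  move=> eq_set; apply: val_inj.
  have := set21 (Ordinal (source_lt e)) (Ordinal (target_lt e)).
  have := set22 (Ordinal (source_lt e)) (Ordinal (target_lt e)).
  rewrite eq_set !inE -!val_eqE /= => /orP[]/eqP tE /orP[]/eqP sE.
  + by have /n_Sn := source_eq_target ek ek (etrans sE (esym tE)).
  + have := source_eq_target ek e'k sE; have := source_eq_target e'k ek (esym tE).
    by move: (_ %/ _) (_ %/ _) => i i' ->; lia.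
  + exact: edge_inj.
  + by have /n_Sn := source_eq_target ek ek (etrans sE (esym tE)).
- rewrite map_inj_uniq ?enum_uniq // => a a' [aa' _]; exact: val_inj.
Qed.

Lemma adj_layered (u v : 'I_(nvert (layered good))) : adj u v ->
  exists e, [/\ e < k * n ^ t.+1, good (e %% n ^ t.+1)
    & val u = source e /\ val v = target e \/ val v = source e /\ val u = target e].
Proof.
rewrite /adj /=; case/orP=> /mapP[e]; rewrite mem_filter => /andP[ge _] [-> ->];
  exists e; split=> //; [by left|by right].
Qed.

Lemma layered_adj e (u v : 'I_(nvert (layered good))) :
  e < k * n ^ t.+1 -> good (e %% n ^ t.+1) ->
  val u = source e -> val v = target e -> adj u v.
Proof.
move=> ek ge uE vE; apply/orP; left; apply/mapP; exists (Ordinal ek).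
  by rewrite mem_filter ge mem_enum.
by congr pair; apply: val_inj.
Qed.

(** Dividing a vertex number by [n ^ t] yields its layer as quotient and its tuple as remainder. *)
Lemma pair_walk d st : st \in pairs (layered good) -> walk d st.1 st.2 ->
  0 < n /\ exists l a, layer_walk k t n good d l a.
Proof.
case/mapP=> b _ -> /walkP[x [/= x0 xd adjx]].
have N0 : 0 < n ^ t by exact: leq_ltn_trans (ltn_ord b).
split; first by case: n N0 => //; rewrite exp0n.
exists (fun j => x j %/ n ^ t), (fun j => x j %% n ^ t).
rewrite /layer_walk x0 xd /= modnMDl divnMDl // divn_small // addn0; split=> // j jd.
have [e [ek ge eE]] := adj_layered (adjx j jd); exists (e %% n ^ t.+1).
have [sd sm] := sourceK ek; have [td tm] := targetK ek; have := layer_lt ek.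
rewrite /traverses; case: eE => -[-> ->]; rewrite sd td sm tm => lt_k.
  by split=> //; [rewrite (minn_idPl (leqnSn _))|left].
by split=> //; [rewrite (minn_idPr (leqnSn _))|right].
Qed.

End LayeredGraph.

(** * From short walks to hypercliques and back *)

Lemma exists_superset (T : finType) (A : {set T}) r :
  #|A| <= r <= #|T| -> exists2 S : {set T}, A \subset S & #|S| = r.
Proof.
case/andP=> Ar; rewrite -(subnKC Ar); elim: (r - #|A|) => [|e IH] leT.
  by exists A; rewrite ?addn0.
have [|S AS cardS] := IH; first by rewrite addnS in leT; exact: ltnW.
have [x xS] : exists x, x \notin S.
  apply/existsP; rewrite -negb_forall; apply/negP=> /forallP all_in.
  have E : S = setT by apply/setP=> y; rewrite all_in inE.
  by move: cardS leT; rewrite E cardsT addnS => ->; rewrite ltnn.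
exists (x |: S); first by rewrite (subset_trans AS) ?subsetUr.
by rewrite cardsU1 xS cardS addnS.
Qed.

Lemma layer_walk_hyperclique r k t n (E : {set {set 'I_n}}) d l a :
  2 <= r -> r <= t.+1 -> t.+1 < k -> 0 < n -> uniform r E ->
  layer_walk k t n (window_ok r t E) d l a ->
  d + 2 * r * (k - t.+1) < 3 * k -> has_hyperclique r k E.
Proof.
move=> r2 rt tk n0 /forall_inP Er [l0 ld ad steps] lt_d.
have t0 : 0 < t by lia.
have [z Hz] := closed_walk_labelling t0 (ltnW tk) steps l0 ld ad lt_d.
(* The reduction modulo [n] only serves typing: the label of a position lying in some r-set is
   already a digit. *)
pose zo p : 'I_n := Ordinal (ltn_pmod (z p) n0).
have zE (S : {set 'I_k}) : #|S| = r -> [set zo p | p in S] \in E.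
  move=> cardS; have [i [w [okw Sw]]] := Hz S cardS.
  pose x (c : 'I_t.+1) : 'I_n := Ordinal (digit_lt w c n0).
  pose f (p : 'I_k) : 'I_t.+1 := inord (offset k i p).
  have fE p : p \in S -> f p = offset k i p :> nat.
    by case/Sw=> off _; rewrite inordK.
  have f_inj : {in S &, injective f}.
    move=> p q pS qS /(congr1 val) /=; rewrite !fE // !offset_lift // => eq_pq.
    apply: val_inj; move: eq_pq => /=; have := ltn_ord p; have := ltn_ord q; have := ltn_ord i.
    by do 2 case: ifP; lia.
  have := window_okP r E (x := x) (fun=> erefl) okw [set f p | p in S].
  rewrite card_in_imset // => /(_ cardS); rewrite -imset_comp.
  congr (_ \in E); apply: eq_in_imset => p pS; apply: val_inj => /=.
  by rewrite fE // (Sw p pS).2 modn_small // -(Sw p pS).2 digit_lt.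
(* Two positions lie in a common set of [r] positions, as [r >= 2]; its image is a hyperedge, so it
   still has [r] elements. *)
have zo_inj : injective zo.
  move=> p q eq_pq; apply/eqP; case: (eqVneq p q) => // neq_pq.
  have [|S pqS cardS] := @exists_superset _ [set p; q] r.
    by rewrite cards2 neq_pq card_ord; lia.
  have := Er _ (zE S cardS); rewrite -cardS => /imset_injP inj_S.
  rewrite subUset !sub1set in pqS; case/andP: pqS => pS qS.
  by move: neq_pq; rewrite (inj_S p q pS qS eq_pq) eqxx.
apply/existsP; exists [set zo p | p in 'I_k]; apply/andP; split.
  by rewrite card_imset // card_ord.
apply/forallP=> e; apply/implyP=> /andP[sub_e /eqP card_e].
have eE : [set zo p | p in zo @^-1: e] = e.
  apply/setP=> y; apply/imsetP/idP => [[p + ->]|ye]; first by rewrite inE.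
  by have /imsetP[p _ yE] := subsetP sub_e y ye; exists p; rewrite // inE -yE.
by rewrite -eE zE // -card_e -[in RHS]eE card_imset.
Qed.

Lemma hyperclique_walk r k t n (E : {set {set 'I_n}}) (K : {set 'I_n}) :
  0 < t -> t.+1 < k -> hyperclique r k E K ->
  exists2 st, st \in pairs (layered k t n (window_ok r t E)) & walk k st.1 st.2.
Proof.
move=> t0 tk /andP[/eqP cardK /forallP KE]; set G := layered _ _ _ _.
have [x0 _] : exists x0, x0 \in K by apply/card_gt0P; rewrite cardK; lia.
have n0 : 0 < n by exact: leq_ltn_trans (ltn_ord x0).
have k0 : 0 < k by lia.
have szK : size (enum K) = k by rewrite -cardE.
(* The hyperclique is read with period [k], so the tuples in layers 0 and [k] coincide; [t.+1 < k]
   keeps the entries of a window distinct. *)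
pose x j := nth x0 (enum K) (j %% k).
have xK j : x j \in K by rewrite -mem_enum mem_nth // szK ltn_pmod.
pose tup m j := numeral n [seq val (x (j + q)) | q <- iota 0 m].
have digits m j : all (fun d => d < n) [seq val (x (j + q)) | q <- iota 0 m].
  by apply/allP=> _ /mapP[q _ ->]; exact: ltn_ord.
have tup_lt m j : tup m j < n ^ m.
  by have := numeral_lt (digits m j); rewrite size_map size_iota.
have tup_mod j : tup t.+1 j %% n ^ t = tup t j.
  rewrite /tup -addn1 iotaD map_cat numeral_cat size_map size_iota.
  by rewrite addnC mulnC modnMDl modn_small // tup_lt.
have tup_div j : tup t.+1 j %/ n = tup t j.+1.
  rewrite /tup /= addnC mulnC divnMDl // divn_small // addn0.
  rewrite -[1]addn0 iotaDl -map_comp; congr numeral.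
  by apply: eq_map => q /=; rewrite addnA addn1.
have tup_ok j : window_ok r t E (tup t.+1 j).
  apply/(window_okP r E (x := fun c : 'I_t.+1 => x (j + c))).
    move=> c; rewrite digit_numeral ?size_map ?size_iota //.
    by rewrite (nth_map 0) ?size_iota // nth_iota.
  move=> A cardA; set e := imset _ _.
  have := KE e; rewrite (_ : #|e| = r) ?eqxx ?andbT; last first.
    rewrite card_in_imset // => c c' _ _ /eqP; rewrite nth_uniq ?enum_uniq ?szK ?ltn_pmod //.
    have := ltn_ord c; have := ltn_ord c' => c't ct.
    by rewrite eqn_modDl !modn_small => [/eqP/val_inj//||]; lia.
  by move/implyP; apply; apply/subsetP=> _ /imsetP[c _ ->].
have tupk : tup t k = tup t 0.
  by congr numeral; apply: eq_map => q; rewrite /x modnDl.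
pose s := Ordinal (tup_lt t 0).
exists (Ordinal (bottom_lt k s), Ordinal (top_lt k s)).
  by apply/mapP; exists s; rewrite ?mem_enum.
have vert_lt j : j <= k -> j * n ^ t + tup t j < k.+1 * n ^ t.
  by move=> jk; rewrite mulSn addnC -addSn leq_add ?leq_mul ?tup_lt.
pose v j : 'I_(nvert G) := insubd (Ordinal (bottom_lt k s)) (j * n ^ t + tup t j).
have vE j : j <= k -> val (v j) = j * n ^ t + tup t j.
  by move=> jk; apply: insubdK; exact: vert_lt.
apply/walkP; exists v; split=> [||j jk]; try by apply: val_inj; rewrite vE ?tupk.
have M0 : 0 < n ^ t.+1 by rewrite expn_gt0 n0.
have wd : (j * n ^ t.+1 + tup t.+1 j) %/ n ^ t.+1 = j.
  by rewrite divnMDl // divn_small ?addn0.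
have wm : (j * n ^ t.+1 + tup t.+1 j) %% n ^ t.+1 = tup t.+1 j.
  by rewrite modnMDl modn_small.
apply: (@layered_adj _ _ _ _ (j * n ^ t.+1 + tup t.+1 j)).
- by rewrite -ltn_divLR // wd.
- by rewrite wm.
- by rewrite vE 1?ltnW // /source wd wm tup_mod.
- by rewrite vE // /target wd wm tup_div.
Qed.

Lemma layered_with_hyperclique r k t n (E : {set {set 'I_n}}) :
  0 < t -> t.+1 < k -> has_hyperclique r k E ->
  pairs_min_dist (layered k t n (window_ok r t E)) = Some k.
Proof.
move=> t0 tk /existsP[K HK]; have [st stP /walk_dist[d stE dk]] := hyperclique_walk t0 tk HK.
have [m mE md] := pairs_min_dist_le stP stE.
have [st' st'P /dist_walk w] := pairs_min_dist_attained mE.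
have [_ [l [a la]]] := pair_walk t0 st'P w.
by rewrite mE; congr Some; have := layer_walk_length la; lia.
Qed.

Lemma layered_without_hyperclique r k t n (E : {set {set 'I_n}}) D :
  2 <= r -> r <= t.+1 -> t.+1 < k -> uniform r E -> D + 2 * r * (k - t.+1) <= 3 * k ->
  ~ has_hyperclique r k E ->
  ole (Some D) (pairs_min_dist (layered k t n (window_ok r t E))).
Proof.
move=> r2 rt tk Er lt_D noK; case mE: (pairs_min_dist _) => [m|] //=.
have [st stP /dist_walk w] := pairs_min_dist_attained mE.
have [n0 [l [a la]]] := pair_walk (ltac:(lia) : 0 < t) stP w.
rewrite leqNgt; apply/negP=> mD; apply: noK.
by apply: (layer_walk_hyperclique r2 rt tk n0 Er la); lia.
Qed.

(** * The program: register 0 holds [n], register 1 the loop counter *)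

(** Exponents are constants of the program, so powers are unrolled at a cost independent of [n]. *)
Fixpoint pow_expr (c : nat) : expr :=
  if c is c'.+1 then Bin Mul (Reg 0) (pow_expr c') else Const 1.

Definition digit_expr (e : expr) (c : nat) : expr :=
  Bin Mod (Bin Div e (pow_expr c)) (Reg 0).

Definition address_expr (e : expr) (S : seq nat) : expr :=
  foldr (fun c a => Bin Add (digit_expr e c) (Bin Mul (Reg 0) a)) (Const 0) S.

Definition window_ok_expr (r t : nat) (e : expr) : expr :=
  foldr (fun S b => Bin Mul (Fetch (address_expr e S)) b) (Const 1)
    (position_sets r t).

Definition layer_expr (t : nat) : expr := Bin Div (Reg 1) (pow_expr t.+1).
Definition window_expr (t : nat) : expr := Bin Mod (Reg 1) (pow_expr t.+1).

Definition source_expr (t : nat) : expr :=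
  Bin Add (Bin Mul (layer_expr t) (pow_expr t))
    (Bin Mod (window_expr t) (pow_expr t)).

Definition target_expr (t : nat) : expr :=
  Bin Add (Bin Mul (Bin Add (layer_expr t) (Const 1)) (pow_expr t))
    (Bin Div (window_expr t) (Reg 0)).

Definition top_expr (k t : nat) : expr :=
  Bin Add (Bin Mul (Const k) (pow_expr t)) (Reg 1).

Definition for_loop (lim : expr) (body : prog) : prog :=
  Seq (Assign 1 (Const 0))
    (While (Bin Lt (Reg 1) lim)
       (Seq body (Assign 1 (Bin Add (Reg 1) (Const 1))))).

Definition pair_body (k t : nat) : prog := Seq (Emit (Reg 1)) (Emit (top_expr k t)).

Definition edge_body (r t : nat) : prog :=
  If (window_ok_expr r t (window_expr t))
    (Seq (Emit (source_expr t)) (Emit (target_expr t))) Skip.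

Definition reduction (r k t : nat) : prog :=
  Seq (Emit (Bin Mul (Const k.+1) (pow_expr t)))
    (Seq (Emit (pow_expr t))
      (Seq (for_loop (pow_expr t) (pair_body k t))
        (for_loop (Bin Mul (Const k) (pow_expr t.+1)) (edge_body r t)))).

(** * Program logic with time bounds *)

Section Execution.

Variables (w n : nat) (m : nat -> nat).

(** The invariant between commands; register 1 is left free for the counter. *)
Definition ready (s : state) (o : seq nat) : Prop :=
  [/\ regs s 0 = n, Defs.mem s =1 m & out s = o].

Definition runs (p : prog) (s : state) (b : nat) (Q : state -> Prop) : Prop :=
  exists T s', [/\ exec w p s T s', Q s' & T <= b].

Lemma runs_seq p1 p2 s b1 b2 Q1 Q2 :
  runs p1 s b1 Q1 -> (forall s', Q1 s' -> runs p2 s' b2 Q2) ->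
  runs (Seq p1 p2) s (b1 + b2) Q2.
Proof.
case=> T1 [s1 [ex1 Qs1 le1]] /(_ s1 Qs1)[T2 [s2 [ex2 Qs2 le2]]].
by exists (T1 + T2), s2; split; [exact: exec_seq ex1 ex2| |exact: leq_add].
Qed.

Lemma runs_emit e v i s o :
  ready s o -> regs s 1 = i -> eval w s e = v ->
  runs (Emit e) s (cost e).+1 (fun s' => ready s' (rcons o v) /\ regs s' 1 = i).
Proof.
move=> [r0 ms os] r1 ev.
by exists (cost e).+1; eexists; split; [exact: exec_emit|rewrite /ready /= ev os|].
Qed.

(** A round costs [cost lim + 2] for the test, at most [B] for the body, 4 for the increment and 1
    for the loop itself. The extra round in [L.+1] pays for the initial assignment and the failing
    test. The counter never exceeds [L], so it does not wrap around. *)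
Lemma runs_for lim body L B (f : nat -> seq nat) s o :
  L < 2 ^ w -> 1 < 2 ^ w ->
  (forall s' o', ready s' o' -> eval w s' lim = L) ->
  (forall i s' o', i < L -> ready s' o' -> regs s' 1 = i ->
     runs body s' B (fun s'' => ready s'' (o' ++ f i) /\ regs s'' 1 = i)) ->
  ready s o ->
  runs (for_loop lim body) s (L.+1 * (cost lim + B + 7))
    (fun s' => ready s' (o ++ flatten (map f (iota 0 L)))).
Proof.
move=> Lw w1 evL step rs; set cond := Bin Lt (Reg 1) lim.
have loop j i s' o' : j + i = L -> ready s' o' -> regs s' 1 = i ->
    runs (While cond (Seq body (Assign 1 (Bin Add (Reg 1) (Const 1))))) s'
      (j * (cost lim + B + 7) + cost lim + 3)
      (fun s'' => ready s'' (o' ++ flatten (map f (iota i j)))).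
  elim: j i s' o' => [|j IH] i s' o' jiL rs' ri.
    exists (cost cond).+1, s'; split; [|by rewrite cats0|rewrite /=; lia].
    by apply: exec_while_done; rewrite /= (evL _ _ rs') ri; lia.
  have [T [s1 [ex1 [rs1 r1] leT]]] := step i s' o' ltac:(lia) rs' ri.
  pose s2 := State (upd (regs s1) 1 i.+1) (Defs.mem s1) (out s1).
  have rs2 : ready s2 (o' ++ f i) by case: rs1 => ? ? ?; split.
  have ex2 : exec w (Assign 1 (Bin Add (Reg 1) (Const 1))) s1 4 s2.
    have := exec_assign w 1 (Bin Add (Reg 1) (Const 1)) s1.
    by rewrite /= r1 (modn_small w1) [i + 1]addn1 (modn_small (_ : i.+1 < _)) //; lia.
  have [T' [s3 [ex3 rs3 leT']]] := IH i.+1 s2 _ ltac:(lia) rs2 erefl.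
  exists (cost cond + (T + 4) + T').+1, s3; split; [|by rewrite /= catA|rewrite /=; lia].
  apply: exec_while_step ex3; last exact: exec_seq ex1 ex2.
  by rewrite /= (evL _ _ rs') ri; lia.
pose s0 := State (upd (regs s) 1 0) (Defs.mem s) (out s).
have rs0 : ready s0 o by case: rs => ? ? ?; split.
have [T [s1 [ex1 rs1 leT]]] := loop L 0 s0 o (addn0 L) rs0 erefl.
exists (2 + T), s1; split=> //; last by lia.
apply: exec_seq ex1; have := exec_assign w 1 (Const 0) s.
by rewrite /= mod0n.
Qed.

End Execution.

(** * Absence of overflow and the values of the expressions *)

Section Reduction.

Variables (r k t n w : nat) (E : {set {set 'I_n}}).
Hypotheses (rt : r <= t.+1) (t_gt0 : 0 < t).
Hypothesis word_large : k.+2 * (n ^ t.+1).+1 <= 2 ^ w.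

(** Vertex numbers, addresses and loop limits all obey this bound; the successor of [n ^ t.+1]
    leaves room for the constants when [n = 0]. *)
Lemma fits_word v : v <= k.+1 * (n ^ t.+1).+1 -> v < 2 ^ w.
Proof.
move=> le_v; apply: leq_trans word_large.
by rewrite mulSn; exact: (leq_add (ltn0Sn (n ^ t.+1)) le_v).
Qed.

Lemma leq_exp_window c : c <= t.+1 -> n ^ c <= (n ^ t.+1).+1.
Proof.
case: (posnP n) => [->|n0 ct]; first by case: c => // c _; rewrite exp0n.
by rewrite leqW // leq_pexp2l.
Qed.

Lemma leq_exp_tuple : n ^ t <= n ^ t.+1.
Proof.
by case: (posnP n) => [->|n0]; rewrite ?exp0n // leq_pexp2l.
Qed.

Lemma leq_fits v : v <= (n ^ t.+1).+1 -> v < 2 ^ w.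
Proof. by move=> le_v; apply/fits_word/(leq_trans le_v); rewrite leq_pmull. Qed.

Local Notation ready := (ready n (fun a => nat_of_bool (tensor r E a))).

Variables (s : state) (o : seq nat).
Hypothesis rs : ready s o.

Lemma eval_pow c : c <= t.+1 -> eval w s (pow_expr c) = n ^ c.
Proof.
have [r0 _ _] := rs; elim: c => [|c IH] ct /=.
  by rewrite modn_small // leq_fits.
rewrite r0 IH; last exact: ltnW.
by rewrite -expnS modn_small // leq_fits // leq_exp_window.
Qed.

Local Opaque pow_expr.

Lemma eval_address e v S : 0 < n -> eval w s e = v ->
  all (fun c => c <= t.+1) S -> size S <= t.+1 ->
  eval w s (address_expr e S) = numeral n (map (digit n v) S).
Proof.
have [r0 _ _] := rs => n0 ev; elim: S => [|c S IH] /= ; first by rewrite mod0n.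
case/andP=> ct St szS; rewrite r0 IH ?(ltnW szS) // eval_pow // ev.
have lt_ds S' : numeral n (map (digit n v) S') < n ^ size S'.
  rewrite -(size_map (digit n v) S'); apply: numeral_lt.
  by apply/allP=> _ /mapP[d _ ->]; exact: digit_lt.
have : numeral n (map (digit n v) (c :: S)) < 2 ^ w.
  apply: leq_fits; apply: leq_trans (leq_exp_window szS).
  exact: ltnW (lt_ds (c :: S)).
rewrite /= -/(digit n v c) => small_cS; rewrite (@modn_small (n * _)) ?modn_small //.
by apply: leq_ltn_trans small_cS; rewrite leq_addl.
Qed.

(** Memory cells are 0 or 1, so their product is the conjunction of the tests. The sets have
    [r <= t.+1] elements, hence the addresses fit in a word. *)
Lemma eval_window_ok e v : 0 < n -> eval w s e = v ->
  eval w s (window_ok_expr r t e) = window_ok r t E v.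
Proof.
have [_ ms _] := rs => n0 ev; rewrite /window_ok_expr /window_ok.
have : all (fun S => all (fun c => c <= t.+1) S && (size S <= t.+1)) (position_sets r t).
  apply/allP=> _ /imageP[A /eqP cardA ->]; rewrite size_map -cardE cardA rt andbT.
  by apply/allP=> _ /mapP[c _ ->]; exact: ltnW (ltn_ord c).
elim: (position_sets r t) => [|S Ss IH] /=; first by rewrite modn_small // leq_fits.
case/andP=> /andP[St szS] /IH ->; rewrite ms (eval_address n0 ev) //.
by rewrite mulnb modn_small // leq_fits //; case: (_ && _).
Qed.

Lemma eval_source e : regs s 1 = e -> e < k * n ^ t.+1 ->
  eval w s (source_expr t) = source t n e.
Proof.
move=> r1 ek; have lt_s := source_lt (Ordinal ek).
have lt_w : source t n e < 2 ^ w.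
  apply: fits_word; apply: ltnW; apply: leq_trans lt_s _.
  by rewrite leq_mul // leqW // leq_exp_tuple.
rewrite /= (eval_pow (leqnn _)) (eval_pow (leqnSn _)) r1.
rewrite (@modn_small (_ * _)); first exact: modn_small lt_w.
by apply: leq_ltn_trans lt_w; rewrite leq_addr.
Qed.

Lemma eval_target e : regs s 1 = e -> e < k * n ^ t.+1 ->
  eval w s (target_expr t) = target t n e.
Proof.
have [r0 _ _] := rs => r1 ek; have lt_s := target_lt (Ordinal ek).
have lt_w : target t n e < 2 ^ w.
  apply: fits_word; apply: ltnW; apply: leq_trans lt_s _.
  by rewrite leq_mul // leqW // leq_exp_tuple.
rewrite /= (eval_pow (leqnn _)) (eval_pow (leqnSn _)) r1 r0.
rewrite (@modn_small 1) ?leq_fits // addn1 (@modn_small (_ %/ _).+1); last first.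
  apply: fits_word; apply: leq_trans (_ : k.+1 <= _); last by rewrite leq_pmulr.
  by rewrite ltnW // ltnS layer_lt.
rewrite (@modn_small (_ * _)); first exact: modn_small lt_w.
by apply: leq_ltn_trans lt_w; rewrite leq_addr.
Qed.

Lemma eval_top a : regs s 1 = a -> a < n ^ t ->
  eval w s (top_expr k t) = k * n ^ t + a.
Proof.
move=> r1 an; have lt_w : k * n ^ t + a < 2 ^ w.
  apply: fits_word; apply: ltnW; apply: leq_trans (top_lt k (Ordinal an)) _.
  by rewrite leq_mul // leqW // leq_exp_tuple.
rewrite /= (eval_pow (leqnSn _)) r1 (@modn_small k); last first.
  by apply: fits_word; rewrite (leq_trans (leqnSn _)) // leq_pmulr.
rewrite (@modn_small (_ * _)); first exact: modn_small lt_w.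
by apply: leq_ltn_trans lt_w; rewrite leq_addr.
Qed.

Lemma eval_const_mul c c' : c <= k.+1 -> c' <= t.+1 -> c * n ^ c' < 2 ^ w ->
  eval w s (Bin Mul (Const c) (pow_expr c')) = c * n ^ c'.
Proof.
move=> ck ct lt_w; rewrite /= (eval_pow ct) (@modn_small c) ?modn_small //.
by apply: fits_word; rewrite (leq_trans ck) // leq_pmulr.
Qed.

End Reduction.

(** * Output and running time of the program *)

Lemma flatten_map_filter (S T : Type) (p : pred S) (f : S -> seq T) s :
  flatten (map f (filter p s)) = flatten (map (fun x => if p x then f x else [::]) s).
Proof. by elim: s => //= x s IH; case: (p x); rewrite /= IH. Qed.

Lemma encode_layered k t n (good : pred nat) : 0 < t ->
  encode (layered k t n good) =
  [:: k.+1 * n ^ t; n ^ t]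
  ++ flatten [seq [:: a; k * n ^ t + a] | a <- iota 0 (n ^ t)]
  ++ flatten [seq (if good (e %% n ^ t.+1) then [:: source t n e; target t n e] else [::])
             | e <- iota 0 (k * n ^ t.+1)].
Proof.
move=> t_gt0; rewrite /encode /= size_map size_enum_ord -!map_comp flatten_map_filter.
by rewrite -[in RHS](val_enum_ord (n ^ t)) -[in RHS](val_enum_ord (k * _)) -!map_comp.
Qed.

Lemma reduction_runs r k t n w (E : {set {set 'I_n}}) :
  r <= t.+1 -> 0 < t -> k.+2 * (n ^ t.+1).+1 <= 2 ^ w ->
  runs w (reduction r k t) (input r E)
    ((cost (Bin Mul (Const k.+1) (pow_expr t))).+1 + ((cost (pow_expr t)).+1
     + ((n ^ t).+1 * (cost (pow_expr t) + (2 + (cost (top_expr k t)).+1) + 7)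
     + (k * n ^ t.+1).+1 * (cost (Bin Mul (Const k) (pow_expr t.+1))
         + (cost (window_ok_expr r t (window_expr t))
            + ((cost (source_expr t)).+1 + (cost (target_expr t)).+1)).+1 + 7))))
    (fun s => out s = encode (layered k t n (window_ok r t E))).
Proof.
move=> rt t_gt0 large.
have Nfits := leq_exp_tuple n t_gt0.
have w1 : 1 < 2 ^ w by apply: (leq_fits large).
have rs0 : ready n (fun a => nat_of_bool (tensor r E a)) (input r E) [::] by split.
have kN : k.+1 * n ^ t < 2 ^ w.
  by apply: (fits_word large); rewrite leq_mul // leqW.
have kM : k * n ^ t.+1 < 2 ^ w.
  by apply: (fits_word large); rewrite leq_mul // ltnW.
have N_small : n ^ t < 2 ^ w by apply: (leq_fits large); rewrite leqW.
apply: runs_seq.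
  by apply: (runs_emit rs0 erefl); apply: (eval_const_mul large rs0).
move=> s1 [rs1 r1]; apply: runs_seq.
  by apply: (runs_emit rs1 r1); apply: (eval_pow large rs1).
move=> s2 [rs2 _]; apply: runs_seq.
  apply: (@runs_for _ _ _ _ _ _ _ (fun a => [:: a; k * n ^ t + a]) _ _ N_small w1 _ _ rs2).
    by move=> s o rs; apply: (eval_pow large rs).
  move=> a s o an rs ra; apply: runs_seq.
    exact: (runs_emit (v := a) rs ra).
  move=> s' [rs' ra'].
  by rewrite -cat_rcons cats1; exact: runs_emit rs' ra' (eval_top t_gt0 large rs' ra' an).
move=> s3 rs3; rewrite encode_layered // catA.
set f := fun e => if _ then _ else _.
suff [T [s' [ex [_ _ os'] leT]]] :
    runs w (for_loop (Bin Mul (Const k) (pow_expr t.+1)) (edge_body r t)) s3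
    ((k * n ^ t.+1).+1 * (cost (Bin Mul (Const k) (pow_expr t.+1))
         + (cost (window_ok_expr r t (window_expr t))
            + ((cost (source_expr t)).+1 + (cost (target_expr t)).+1)).+1 + 7))
    (fun s' => ready n (fun a => nat_of_bool (tensor r E a)) s'
       (([:: k.+1 * n ^ t; n ^ t] ++ flatten [seq [:: a; k * n ^ t + a] | a <- iota 0 (n ^ t)])
        ++ flatten (map f (iota 0 (k * n ^ t.+1))))).
  by exists T, s'.
apply: (runs_for kM w1 _ _ rs3).
  by move=> s o rs; exact: (eval_const_mul large rs (leqnSn k) (leqnn _) kM).
move=> e s o ek rs re; have n0 := n_gt0 ek.
have ev : eval w s (window_expr t) = e %% n ^ t.+1.
  rewrite -[LHS]/(eval w s (Reg 1) %% eval w s (pow_expr t.+1)).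
  by rewrite (eval_pow large rs) //= re.
have okE := eval_window_ok rt large rs n0 ev.
rewrite /f; case: ifP => ok; rewrite ok in okE; last first.
  exists (cost (window_ok_expr r t (window_expr t)) + 1).+1, s; split.
  - by apply: exec_if; rewrite okE; exact: exec_skip.
  - by rewrite cats0.
  - by rewrite ltnS leq_add2l addSn.
suff [T [s' [ex out_s' leT]]] :
    runs w (Seq (Emit (source_expr t)) (Emit (target_expr t))) s
      ((cost (source_expr t)).+1 + (cost (target_expr t)).+1)
      (fun s' => ready n (fun a => nat_of_bool (tensor r E a)) s'
         (o ++ [:: source t n e; target t n e]) /\ regs s' 1 = e).
  exists (cost (window_ok_expr r t (window_expr t)) + T).+1, s'; split=> //.
    by apply: exec_if; rewrite okE.
  by rewrite ltnS leq_add2l.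
apply: runs_seq; first exact: runs_emit rs re (eval_source t_gt0 large rs re ek).
move=> s' [rs' re']; rewrite -cat_rcons cats1.
exact: runs_emit rs' re' (eval_target t_gt0 large rs' re' ek).
Qed.

Theorem theorem2 :
  exists c : nat,
  forall r k t : nat,
    2 <= r -> r <= t + 1 -> t + 1 <= k - 1 ->
  let D := 2 * r * (t + 1) - (2 * r - 3) * k in
    k < D ->
  exists (p : prog) (C : nat),
  forall (n : nat) (E : {set {set 'I_n}}),
    uniform r E ->
  exists I : instance,
    [/\ produces_within r p (C * (n ^ (t + 1) + 1)) E I,
        well_formed I,
        [/\ nvert I <= c * (k * n ^ t),
            size (edges I) <= c * (k * n ^ (t + 1))
          & size (pairs I) <= c * nvert I],
        has_hyperclique r k E -> pairs_min_dist I = Some k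
      & ~ has_hyperclique r k E -> ole (Some D) (pairs_min_dist I)].
Proof.
(* The factor 2 comes from the [k.+1] layers, as [k.+1 <= 2 * k]. *)
exists 2 => r k t r2 rt tk D kD.
have {}rt : r <= t.+1 by lia.
have {}tk : t.+1 < k by lia.
have t_gt0 : 0 < t by lia.
pose c1 := (cost (Bin Mul (Const k.+1) (pow_expr t))).+1.
pose c2 := (cost (pow_expr t)).+1.
pose b1 := cost (pow_expr t) + (2 + (cost (top_expr k t)).+1) + 7.
pose b2 := cost (Bin Mul (Const k) (pow_expr t.+1))
  + (cost (window_ok_expr r t (window_expr t))
     + ((cost (source_expr t)).+1 + (cost (target_expr t)).+1)).+1 + 7.
(* The first four summands pay for the running time; [k.+2] makes the time bound large enough that
   words of the allowed lengths do not overflow. *)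
exists (reduction r k t), (c1 + c2 + b1 + k * b2 + k.+2) => n E Er.
exists (layered k t n (window_ok r t E)); rewrite !addn1.
split.
- move=> w large; have NM := leq_exp_tuple n t_gt0.
  have [|T [s [ex out_s leT]]] := @reduction_runs r k t n w E rt t_gt0.
    by apply: leq_trans large; rewrite leq_mul2r leq_addl orbT.
  exists T, s; split=> //; apply: leq_trans leT _.
  rewrite -/c1 -/c2 -/b1 -/b2 {large ex}; move: c1 c2 b1 b2 (n ^ t) (n ^ t.+1) NM.
  move=> c1 c2 b1 b2 N M NM.
  have -> : (c1 + c2 + b1 + k * b2 + k.+2) * M.+1
      = c1 * M.+1 + (c2 * M.+1 + (b1 * M.+1 + (k * b2 * M.+1 + k.+2 * M.+1))).
    by rewrite !mulnDl !addnA.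
  apply: leq_add; first exact: leq_pmulr.
  apply: leq_add; first exact: leq_pmulr.
  apply: leq_add; first by rewrite mulnC leq_mul2l ltnS NM orbT.
  apply: leq_trans (leq_addr _ _); rewrite mulnAC leq_mul2r mulnS -add1n leq_add2r.
  by rewrite (leq_ltn_trans _ tk) ?orbT.
- exact: layered_well_formed.
- split.
  + by rewrite /= mulnA leq_mul2r mul2n -addnn -addn1 leq_add2l (leq_ltn_trans _ tk) ?orbT.
  + rewrite /= size_map size_filter (leq_trans (count_size _ _)) // size_enum_ord.
    by rewrite leq_pmull.
  + by rewrite /= size_map size_enum_ord mulnA leq_pmull.
- exact: layered_with_hyperclique.
- apply: layered_without_hyperclique => //; rewrite /D.
  (* Since [k < D], the truncated subtraction in [D] is exact, and [D] plus [2 * r * (k - t.+1)] is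
     exactly [3 * k]. *)
  have le_2r : 2 * r * (k - t.+1) = 2 * r * k - 2 * r * t.+1 by rewrite mulnBr.
  have le_3 : (2 * r - 3) * k = 2 * r * k - 3 * k by rewrite mulnBl.
  have kt : 2 * r * t.+1 <= 2 * r * k by rewrite leq_mul2l ltnW ?orbT.
  have r3 : 3 * k <= 2 * r * k by rewrite leq_mul2r; lia.
  move: kD; rewrite /D addn1; lia.
Qed.
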